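(* Let $k,n$ be non-negative integers and let $p_1,\dots,p_{k+1}$ be primes (not necessarily distinct) with each $p_i\equiv 3,5,$ or $7\pmod 8$. Then for every integer $j$ not divisible by $p_{k+1}$, $$\mathcal{J}_{6}\Big(3p_1^2p_2^2\cdots p_k^2\,p_{k+1}\,\big(8p_{k+1}n+8j+p_{k+1}\big)\Big)\equiv 0\pmod 2.$$
   Context: Let $q=e^{2\pi i\tau}$, $(a;q)_\infty=\prod_{j\ge0}(1-aq^j)$, and $\eta(\tau)=q^{1/24}(q;q)_\infty$. Define $$j_6(\tau)=\left(\frac{\eta(2\tau)\eta(3\tau)^3}{\eta(\tau)\eta(6\tau)^3}\right)^3-3=\frac1q+\sum_{n\ge0}\mathcal{J}_6(n)q^n.$$ *)

(* Defs.v *)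
From HB Require Import structures.
From mathcomp Require Import all_boot all_order all_algebra.
Set Implicit Arguments. Unset Strict Implicit. Unset Printing Implicit Defensive.
Import Order.TTheory GRing.Theory Num.Theory.
Local Open Scope ring_scope.

Definition geom (d N : nat) : {poly int} := \sum_(i < N.+1) 'X^(d * i).

(* F(q) = ( (q^2;q^2)(q^3;q^3)^3 / ((q;q)(q^6;q^6)^3) )^3
        = prod_{j>=1} (1-q^{2j})^3 (1-q^{3j})^9 / ((1-q^j)^3 (1-q^{6j})^9).
   Fpoly N agrees with F(q) modulo q^(N+1): factors with j > N are 1 mod
   q^(N+1), and each 1/(1-q^d) is replaced by its truncation. *)
Definition Fpoly (N : nat) : {poly int} :=
  \prod_(1 <= j < N.+1)
     ((1 - 'X^(2 * j)) ^+ 3 * (1 - 'X^(3 * j)) ^+ 9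
      * geom j N ^+ 3 * geom (6 * j) N ^+ 9).

Definition Fcoef (m : nat) : int := (Fpoly m)`_m.

(* j_6 = q^{-1} F(q) - 3 (the eta-quotient cubed has leading power q^{-1}).
   J6 m is the coefficient of q^m in j_6, for every integer m
   (so J6 (-1) = 1, J6 m = 0 for m < -1, and J6 n = \mathcal{J}_6(n) for n >= 0). *)
Definition J6 (m : int) : int :=
  match m with
  | Posz a => Fcoef a.+1 - 3 * (a == 0%N)%:R
  | Negz 0 => 1
  | Negz _ => 0
  end.

(* Main.v *)
(* Write E_d = prod_j (1 - q^(d j)) and psi(q) = sum_(i >= 0) q^(i (i + 1) / 2).
   Modulo 2 one has E_(2 d) = E_d^2, Gauss' identity gives E_1^3 = psi(q), and
   F = q j_6 + 3 q satisfies F E_3^9 = E_1^3. A parity-preserving involution on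
   the representations by x^2 + 3 y^2 gives psi(q) psi(q^3) = psi(q^4) + q psi(q^12)
   modulo 2. Hence F E_12 E_24 = psi(q^4) + q psi(q^12); extracting the exponents
   0 mod 4, then 1 mod 3, then 0 mod 2 (each time dividing out a series in the
   corresponding power of q, and using the last identity once more) shows that the
   coefficient of q^(24 u + 4) in F has the parity of the coefficient of q^u in psi.
   So J6(3 M) is even whenever M = 1 mod 8 is not a square, and the M of the
   theorem has odd p_(k+1)-adic valuation. *)
Require Import Defs.
From HB Require Import structures.
From mathcomp Require Import all_boot all_order all_algebra.
From mathcomp Require Import zify ring.
Set Implicit Arguments. Unset Strict Implicit. Unset Printing Implicit Defensive.
Import Order.TTheory GRing.Theory Num.Theory.
Local Open Scope ring_scope.

(** * Triangular numbers and Shanks' finite identity *)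

Definition tri (i : nat) : nat := (i * i.+1) %/ 2.

Lemma double_tri i : (2 * tri i = i * i.+1)%N.
Proof. rewrite /tri mulnC divnK // dvdn2 oddM /=; lia. Qed.

(* Shanks' finite form of Gauss' identity psi = E_2^2 / E_1 involves the quotients
   P_n / P_s, where P_n = prod_(1 <= k <= n) (1 - x^(2k)) / (1 - x^(2k-1)); this is
   P_n / P_s multiplied by prod_(1 <= k <= n) (1 - x^(2k-1)). *)
Definition shanks_term (R : comNzRingType) (x : R) (n s : nat) : R :=
  \prod_(s <= k < n) (1 - x ^+ (2 * k.+1)) * \prod_(0 <= k < s) (1 - x ^+ (2 * k).+1).

(** Induction on [n]: with y = x^(2n+1), the terms for n + 1 minus (1 - y) times those for n
    telescope in s, leaving exactly the two new powers of x on the left. *)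
Lemma shanks (R : comNzRingType) (x : R) (n : nat) :
  \prod_(0 <= k < n) (1 - x ^+ (2 * k).+1) * \sum_(0 <= i < 2 * n) x ^+ tri i
  = \sum_(0 <= s < n) shanks_term x n s * x ^+ (s * (2 * n).+1).
Proof.
elim: n => [|n IHn]; first by rewrite muln0 !big_geq // mulr0.
have tri0 : tri (2 * n) = (n * (2 * n).+1)%N by have := double_tri (2 * n); nia.
have tri1 : tri (2 * n).+1 = (n * (2 * n).+1 + (2 * n).+1)%N.
  by have := double_tri (2 * n).+1; nia.
have -> : (2 * n.+1 = (2 * n).+2)%N by lia.
rewrite !big_nat_recr //= tri0 tri1.
set D := \prod_(0 <= k < n) _ in IHn *; set S := \sum_(0 <= i < 2 * n) _ in IHn *.
set y := x ^+ (2 * n).+1 in IHn *.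
transitivity ((1 - y) * (D * S)
    + D * (1 - y) * (x ^+ (n * (2 * n).+1) + x ^+ (n * (2 * n).+1 + (2 * n).+1))).
  by ring.
rewrite IHn big_distrr /=.
(* Closed form of the partial sums over s, proved by a second induction; the case m = n is the one
   used. *)
have tel m : (m <= n)%N ->
  \sum_(0 <= s < m) (shanks_term x n.+1 s * x ^+ (s * (2 * n).+3)
     - (1 - y) * (shanks_term x n s * x ^+ (s * (2 * n).+1)))
  = shanks_term x n m * (1 - x ^+ (2 * m)) * y ^+ m.
  elim: m => [|m IHm] le_mn; first by rewrite big_geq // muln0 subrr mulr0 mul0r.
  rewrite big_nat_recr //= IHm ?(ltnW le_mn) //.
  rewrite /shanks_term (big_nat_recr n) /=; last by lia.
  rewrite (big_ltn le_mn) (big_nat_recr m) //=.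
  set A := \prod_(m.+1 <= k < n) _; set B := \prod_(0 <= k < m) _.
  have -> : x ^+ (m * (2 * n).+3) = y ^+ m * x ^+ m ^+ 2.
    by rewrite -!exprM -exprD; congr (x ^+ _); lia.
  have -> : x ^+ (m * (2 * n).+1) = y ^+ m by rewrite -exprM mulnC.
  have -> : x ^+ (2 * n.+1) = x * y by rewrite -exprS; congr (x ^+ _); lia.
  have -> : x ^+ (2 * m.+1) = x ^+ m ^+ 2 * x ^+ 2.
    by rewrite -!exprM -exprD; congr (x ^+ _); lia.
  have -> : x ^+ (2 * m).+1 = x ^+ m ^+ 2 * x.
    by rewrite -!exprM -exprSr; congr (x ^+ _); lia.
  have -> : x ^+ (2 * m) = x ^+ m ^+ 2 by rewrite -!exprM mulnC.
  by rewrite (exprS y); ring.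
have := tel n (leqnn n); rewrite sumrB => /(canRL (subrK _)) ->.
have -> : shanks_term x n n = D by rewrite /shanks_term big_geq // mul1r.
have -> : shanks_term x n.+1 n = (1 - x ^+ (2 * n.+1)) * D.
  by rewrite /shanks_term big_nat1.
have -> : x ^+ (n * (2 * n).+1) = y ^+ n by rewrite -exprM mulnC.
have -> : x ^+ (n * (2 * n).+1 + (2 * n).+1) = y ^+ n.+1.
  by rewrite -exprM; congr (x ^+ _); lia.
have -> : x ^+ (n * (2 * n).+3) = y ^+ n * x ^+ n ^+ 2.
  by rewrite -!exprM -exprD; congr (x ^+ _); lia.
have -> : x ^+ (2 * n.+1) = x * y by rewrite -exprS; congr (x ^+ _); lia.
have xy : y = x * x ^+ n ^+ 2 by rewrite -!exprM -exprS; congr (x ^+ _); lia.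
have -> : x ^+ (2 * n) = x ^+ n ^+ 2 by rewrite -!exprM mulnC.
by rewrite (exprS y); set Y := y ^+ n; rewrite xy; ring.
Qed.

(** * The involution on representations by x^2 + 3 y^2 *)

(* With X = 2 a + 1 and Y = 2 b + 1 this is the reflection
   (X, Y) |-> ((X + 3 Y) / 2, (X - Y) / 2), which preserves X^2 + 3 Y^2; the sign of Y
   is first chosen so that X - Y = 2 mod 4, then absolute values are taken. *)
Definition flip (ab : nat * nat) : nat * nat :=
  let: (a, b) := ab in
  if ((a + b) %% 2 == 1)%N then ((a + 3 * b + 1) %/ 2, (maxn a b - minn a b - 1) %/ 2)%N
  else ((maxn a (3 * b + 1) - minn a (3 * b + 1) - 1) %/ 2, (a + b) %/ 2)%N.

Arguments flip : simpl never.

Lemma flipK : involutive flip.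
Proof.
case=> a b; rewrite /flip.
case: ifP => ab; case: ifP => ab'; congr pair; lia.
Qed.

(** The fixed points are X = Y and X = 3 Y; they produce the exponents 4 tri b and 12 tri b + 1 of
    [psi_psi3]. *)
Lemma flip_fix a b : (flip (a, b) == (a, b)) = (a == b) || (a == 3 * b + 1)%N.
Proof.
by rewrite /flip; case: ifP => ab; rewrite xpair_eqE; lia.
Qed.

(** Since 8 (tri a + 3 tri b) + 4 = X^2 + 3 Y^2, this is the invariance of the form. The witnesses
    below remove halvings and truncated subtractions, so that only polynomial identities remain. *)
Lemma tri_flip a b :
  (tri (flip (a, b)).1 + 3 * tri (flip (a, b)).2 = tri a + 3 * tri b)%N.
Proof.
rewrite /flip; case: eqP => ab /=.
- have [le_ab|le_ba] := leqP a b.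
  + have [c ->] : exists c, b = (a + 2 * c + 1)%N by exists ((b - a) %/ 2)%N; lia.
    have -> : ((a + 3 * (a + 2 * c + 1) + 1) %/ 2 = 2 * a + 3 * c + 2)%N by lia.
    have -> : ((a + 2 * c + 1 - a - 1) %/ 2 = c)%N by lia.
    have := double_tri (2 * a + 3 * c + 2); have := double_tri c.
    have := double_tri (a + 2 * c + 1); have := double_tri a; nia.
  have [c ->] : exists c, a = (b + 2 * c + 1)%N by exists ((a - b) %/ 2)%N; lia.
  have -> : ((b + 2 * c + 1 + 3 * b + 1) %/ 2 = 2 * b + c + 1)%N by lia.
  have -> : ((b + 2 * c + 1 - b - 1) %/ 2 = c)%N by lia.
  have := double_tri (2 * b + c + 1); have := double_tri c.
  have := double_tri (b + 2 * c + 1); have := double_tri b; nia.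
have [le_ab|le_ba] := leqP a (3 * b + 1).
- have [r sr] : exists r, (r + (a + b) %/ 2 = 2 * b)%N by exists ((3 * b - a) %/ 2)%N; lia.
  set s := ((a + b) %/ 2)%N in sr *.
  have sa : (a + b = 2 * s)%N by rewrite /s; lia.
  have -> : ((3 * b + 1 - a - 1) %/ 2 = r)%N by lia.
  have := double_tri r; have := double_tri s; have := double_tri a.
  by have := double_tri b; nia.
have [c ->] : exists c, a = (3 * b + 2 + 2 * c)%N by exists ((a - 3 * b - 2) %/ 2)%N; lia.
have -> : ((3 * b + 2 + 2 * c + b) %/ 2 = 2 * b + 1 + c)%N by lia.
have -> : ((3 * b + 2 + 2 * c - (3 * b + 1) - 1) %/ 2 = c)%N by lia.
have := double_tri (2 * b + 1 + c); have := double_tri c.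
by have := double_tri (3 * b + 2 + 2 * c); have := double_tri b; nia.
Qed.

(** * Power series arithmetic modulo X^N *)

Definition eqX {F : fieldType} (N : nat) (p q : {poly F}) : Prop := 'X^N %| p - q.

Lemma eqXP (F : fieldType) (N : nat) (p q : {poly F}) :
  eqX N p q <-> (forall i, (i < N)%N -> p`_i = q`_i).
Proof.
rewrite /eqX; split=> [/modp_eq0P | eqpq].
  rewrite -Pdiv.IdomainMonic.take_poly_modp => /polyP pq i ltiN.
  have := pq i; rewrite coef_take_poly ltiN coefB coef0 => /eqP.
  by rewrite subr_eq0 => /eqP.
apply/modp_eq0P; rewrite -Pdiv.IdomainMonic.take_poly_modp; apply/polyP=> i.
rewrite coef_take_poly coefB coef0; case: ifP => // ltiN.
by rewrite eqpq ?subrr.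
Qed.

Lemma eqX_refl (F : fieldType) (N : nat) (p : {poly F}) : eqX N p p.
Proof. by apply/eqXP. Qed.

Lemma eqX_sym (F : fieldType) (N : nat) (p q : {poly F}) : eqX N p q -> eqX N q p.
Proof. by move/eqXP=> pq; apply/eqXP=> i /pq. Qed.

Lemma eqX_trans (F : fieldType) (N : nat) (q p r : {poly F}) :
  eqX N p q -> eqX N q r -> eqX N p r.
Proof.
by move=> /eqXP pq /eqXP qr; apply/eqXP=> i ltiN; rewrite pq ?qr.
Qed.

Lemma eqX_le (F : fieldType) (M N : nat) (p q : {poly F}) :
  (M <= N)%N -> eqX N p q -> eqX M p q.
Proof.
by move=> leMN /eqXP pq; apply/eqXP=> i /leq_trans-/(_ _ leMN); apply: pq.
Qed.

Lemma eqXM (F : fieldType) (N : nat) (p q r s : {poly F}) :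
  eqX N p q -> eqX N r s -> eqX N (p * r) (q * s).
Proof.
rewrite /eqX => pq rs.
have -> : p * r - q * s = (p - q) * r + q * (r - s) by ring.
by apply: dvdp_add; [apply: dvdp_mulr | apply: dvdp_mull].
Qed.

Lemma eqXexp (F : fieldType) (N k : nat) (p q : {poly F}) :
  eqX N p q -> eqX N (p ^+ k) (q ^+ k).
Proof.
by move=> pq; elim: k => [|k IHk]; rewrite ?expr0 ?exprS; [exact: eqX_refl | exact: eqXM].
Qed.

Lemma eqX_prod_nat (F : fieldType) (N m n : nat) (p q : nat -> {poly F}) :
    (forall i, (m <= i < n)%N -> eqX N (p i) (q i)) ->
  eqX N (\prod_(m <= i < n) p i) (\prod_(m <= i < n) q i).
Proof.
move=> pq; rewrite big_nat_cond [X in eqX _ _ X]big_nat_cond.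
apply: (big_ind2 (eqX N)) => [|? ? ? ?|i]; [exact: eqX_refl | exact: eqXM |].
by rewrite andbT; apply: pq.
Qed.

(** A constant coefficient 1 makes [r] coprime to X, hence to X^N. *)
Lemma eqX_cancel (F : fieldType) (N : nat) (r p q : {poly F}) :
  r`_0 = 1 -> eqX N (p * r) (q * r) -> eqX N p q.
Proof.
move=> r0; rewrite /eqX -mulrBl Gauss_dvdpl // coprimep_expl //.
rewrite coprimep_sym -['X]subr0 -polyC0 coprimep_XsubC /root horner_coef0 r0.
exact: oner_neq0.
Qed.

Lemma eqX_comp (F : fieldType) (N d : nat) (p q : {poly F}) :
  (0 < d)%N -> eqX N p q -> eqX N (p \Po 'X^d) (q \Po 'X^d).
Proof.
move=> d_gt0 /eqXP pq; apply/eqXP=> i ltiN; rewrite !coef_comp_poly_Xn //.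
by case: ifP => // _; apply: pq; apply: leq_ltn_trans ltiN; exact: leq_div.
Qed.

(** * Extraction of arithmetic progressions of exponents *)

(** For d > 0 the bound [size p] loses nothing, because d i + a >= i. *)
Definition section {F : fieldType} (d a : nat) (p : {poly F}) : {poly F} :=
  \poly_(i < size p) p`_(d * i + a).

Lemma coef_section (F : fieldType) (d a i : nat) (p : {poly F}) :
  (0 < d)%N -> (section d a p)`_i = p`_(d * i + a).
Proof.
move=> d_gt0; rewrite coef_poly; case: ltnP => // le_p_i.
by rewrite nth_default // (leq_trans le_p_i) // (leq_trans (leq_pmull i d_gt0)) ?leq_addr.
Qed.

Lemma sectionD (F : fieldType) (d a : nat) (p q : {poly F}) :
  (0 < d)%N -> section d a (p + q) = section d a p + section d a q.
Proof. by move=> d_gt0; apply/polyP=> i; rewrite !(coefD, coef_section). Qed.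

(** Series in X^d act as scalars on each residue class mod d, which is what lets them be divided out
    after an extraction. *)
Lemma section_mul_comp (F : fieldType) (d a : nat) (p q : {poly F}) :
  (a < d)%N -> section d a (p * (q \Po 'X^d)) = section d a p * q.
Proof.
move=> lt_a_d; have d_gt0 : (0 < d)%N by lia.
elim/poly_ind: q => [|q c IHq].
  by rewrite comp_poly0 !mulr0; apply/polyP=> i; rewrite coef_section ?coef0.
rewrite comp_poly_MXaddC mulrDr sectionD // [RHS]mulrDr.
congr (_ + _); last by apply/polyP=> i; rewrite !(coefMC, coef_section).
rewrite !mulrA -IHq; apply/polyP=> i.
rewrite coefMX !coef_section // coefMXn.
case: i => [|i] /=; first by rewrite muln0 add0n lt_a_d.
by rewrite ifF; [congr (_`_ _) | apply/negbTE]; lia.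
Qed.

Lemma section_XnM_comp (F : fieldType) (d a b : nat) (q : {poly F}) :
  (a < d)%N -> (b < d)%N ->
  section d a ('X^b * (q \Po 'X^d)) = if a == b then q else 0.
Proof.
move=> lt_a_d lt_b_d; rewrite section_mul_comp //.
suff -> : section d a 'X^b = (a == b)%:R :> {poly F} by case: eqP; rewrite (mul1r, mul0r).
apply/polyP=> i; rewrite coef_section ?coefXn; last by lia.
case: i => [|i]; first by rewrite muln0 add0n; case: eqP; rewrite ?coef1 ?coef0.
by case: eqP; case: eqP => ? ?; rewrite ?coef1 ?coef0 //; nia.
Qed.

(** For M > 0 the bound reads d (M - 1) + a < N: the largest exponent read lies within the known
    precision. *)
Lemma eqX_section (F : fieldType) (d a M N : nat) (p q : {poly F}) : (0 < d)%N ->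
  (d * M + a < N + d)%N -> eqX N p q -> eqX M (section d a p) (section d a q).
Proof.
move=> d_gt0 leMN /eqXP pq; apply/eqXP=> i ltiM; rewrite !coef_section //.
by apply: pq; nia.
Qed.

(** * Frobenius and reduction modulo 2 *)

Lemma sqr_polyF2 (p : {poly 'F_2}) : p ^+ 2 = p \Po 'X^2.
Proof.
have char2 : 2 \in [pchar {poly 'F_2}] by rewrite pchar_poly pchar_Fp.
elim/poly_ind: p => [|p c IHp]; first by rewrite comp_poly0 expr0n.
rewrite comp_poly_MXaddC -IHp sqrrD exprMn -(mulr_natr _ 2) (pcharf0 char2) mulr0 addr0.
by rewrite -polyC_exp; case: c => [[|[|]] ? //]; congr (_ + _%:P); apply: val_inj.
Qed.

Lemma comp_polyXn_Xn (F : fieldType) (p : {poly F}) a b :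
  (p \Po 'X^a) \Po 'X^b = p \Po 'X^(b * a).
Proof. by rewrite -comp_polyA comp_Xn_poly exprM. Qed.

Lemma exp2_polyF2 (p : {poly 'F_2}) k : p ^+ (2 ^ k) = p \Po 'X^(2 ^ k).
Proof.
elim: k => [|k IHk]; first by rewrite expr1 comp_polyXr.
by rewrite expnSr exprM IHk sqr_polyF2 comp_polyXn_Xn mulnC.
Qed.

Lemma F2_intr_eq0 (c : int) : c%:~R = 0 :> 'F_2 -> (2 %| c)%Z.
Proof.
have char2 : 2 \in [pchar 'F_2] by rewrite pchar_Fp.
rewrite dvdzE /=; case: c => n.
  by move/eqP; rewrite -(dvdn_pcharf char2).
by move/eqP; rewrite NegzE mulrNz oppr_eq0 -(dvdn_pcharf char2).
Qed.

(** * Gauss' identity modulo 2 *)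

(** This and [psi] are exact modulo X^N: omitted factors have j >= N, omitted terms have tri i >= i
    >= N. *)
Definition euler (N : nat) : {poly 'F_2} := \prod_(1 <= j < N) (1 - 'X^j).
Definition psi (N : nat) : {poly 'F_2} := \sum_(0 <= i < N) 'X^(tri i).

Lemma leq_tri i : (i <= tri i)%N.
Proof. by have := double_tri i; nia. Qed.

Lemma eqX_XnM (F : fieldType) N k (p : {poly F}) : (N <= k)%N -> eqX N (p * 'X^k) 0.
Proof.
move=> leNk; apply/eqXP=> i ltiN; rewrite coefMXn coef0.
by rewrite (leq_trans ltiN leNk).
Qed.

Lemma eqXD (F : fieldType) N (p q r s : {poly F}) :
  eqX N p q -> eqX N r s -> eqX N (p + r) (q + s).
Proof.
by move=> /eqXP pq /eqXP rs; apply/eqXP=> i ltiN; rewrite !coefD pq ?rs.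
Qed.

Lemma psiS N : psi N.+1 = psi N + 'X^(tri N).
Proof. by rewrite /psi big_nat_recr. Qed.

Lemma eulerS N : (0 < N)%N -> euler N.+1 = euler N * (1 - 'X^N).
Proof. by move=> N_gt0; rewrite /euler big_nat_recr. Qed.

Lemma psi_le M N : (M <= N)%N -> eqX M (psi N) (psi M).
Proof.
elim: N => [|N IHN] leMN; first by rewrite (_ : M = 0%N); [exact: eqX_refl | lia].
have [->|neMN] := eqVneq M N.+1; first exact: eqX_refl.
rewrite psiS -[psi M]addr0; apply: eqXD; first by apply: IHN; lia.
by rewrite -['X^_]mul1r; apply: eqX_XnM; have := leq_tri N; lia.
Qed.

Lemma euler_le M N : (M <= N)%N -> eqX M (euler N) (euler M).
Proof.
elim: N => [|N IHN] leMN; first by rewrite (_ : M = 0%N); [exact: eqX_refl | lia].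
have [->|neMN] := eqVneq M N.+1; first exact: eqX_refl.
case: N => [|N] in IHN leMN neMN *; first by rewrite /euler !big_geq //; exact: eqX_refl.
rewrite eulerS // -[euler M]mulr1; apply: eqXM.
  by apply: IHN; lia.
rewrite -[1 in X in eqX _ _ X]addr0; apply: eqXD; first exact: eqX_refl.
by rewrite -['X^_]mul1r -mulNr; apply: eqX_XnM; lia.
Qed.

Lemma euler_coef0 N : (euler N)`_0 = 1.
Proof.
rewrite /euler big_nat_cond.
apply: (big_ind (fun p : {poly 'F_2} => p`_0 = 1)) => [|p q p0 q0|].
  by rewrite coef1.
  by rewrite coef0M p0 q0 mulr1.
by move=> [|i] // _; rewrite coefB coef1 coefXn subr0.
Qed.

Lemma euler_comp N d : euler N \Po 'X^d = \prod_(1 <= j < N) (1 - 'X^(d * j)).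
Proof.
rewrite /euler rmorph_prod; apply: eq_bigr => j _.
by rewrite rmorphB rmorph1 /= comp_Xn_poly exprM.
Qed.

Lemma psi_comp N d : psi N \Po 'X^d = \sum_(0 <= i < N) 'X^(d * tri i).
Proof.
rewrite /psi linear_sum; apply: eq_bigr => j _.
by rewrite /= comp_Xn_poly exprM.
Qed.

Lemma euler_odd_even N :
  \prod_(0 <= k < N) (1 - 'X ^+ (2 * k).+1) * (euler N.+1 \Po 'X^2) = euler (2 * N).+1.
Proof.
rewrite euler_comp big_add1 /= -big_split /=; elim: N => [|N IHN].
  by rewrite /euler !big_geq.
rewrite big_nat_recr //= IHN (_ : (2 * N.+1).+1 = (2 * N).+3)%N; last by lia.
rewrite !(@eulerS _.+1) // -mulrA.
by rewrite (_ : 2 * N.+1 = (2 * N).+2)%N; last by lia.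
Qed.

(** Let D be the product of the odd factors. Modulo X^N only s = 0 survives in [shanks], so D psi =
    E_2. Multiplying by E_2, with D E_2 = E_1 and E_2 = E_1^2, gives E_1 psi = E_1^4, and E_1
    cancels. *)
Lemma gauss N : eqX N (euler N ^+ 3) (psi N).
Proof.
case: N => [|n]; first by apply/eqXP.
set N := n.+1; pose D : {poly 'F_2} := \prod_(0 <= k < N) (1 - 'X ^+ (2 * k).+1).
have E2 : eqX N (euler N.+1 \Po 'X^2) (euler N ^+ 2).
  by rewrite -sqr_polyF2; apply/eqXexp/euler_le.
have Dpsi : eqX N (D * psi N) (euler N ^+ 2).
  apply: eqX_trans E2; apply: (@eqX_trans _ _ (D * psi (2 * N))).
    by apply: eqXM; [exact: eqX_refl | apply/eqX_sym/psi_le; lia].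
  rewrite /D /psi shanks big_ltn // mul0n expr0 mulr1 -[X in eqX _ _ X]addr0.
  apply: eqXD.
    rewrite /shanks_term [X in _ * X]big_geq // mulr1 euler_comp big_add1.
    exact: eqX_refl.
  rewrite big_nat_cond; apply: (big_ind (fun p => eqX N p 0)).
  - exact: eqX_refl.
  - by move=> p q p0 q0; rewrite -[0]addr0; apply: eqXD.
  - by move=> [|i] // _; apply: eqX_XnM; nia.
apply: (@eqX_cancel _ _ (euler N)); first exact: euler_coef0.
rewrite -exprSr [_ * euler N]mulrC; apply: eqX_sym.
have : eqX N (D * psi N * (euler N.+1 \Po 'X^2)) (euler N ^+ 4).
  by rewrite -[4%N]/(2 + 2)%N exprD; apply: eqXM.
apply: eqX_trans; rewrite mulrAC euler_odd_even; apply: eqXM; last exact: eqX_refl.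
by apply/eqX_sym/euler_le; lia.
Qed.

(** * The product psi(q) psi(q^3) modulo 2 *)

(** Points that are not fixed cancel in pairs. The hypotheses on [f] are restricted to [S] because
    the truncated [flip] of [psi_psi3] is controlled only there. *)
Lemma sum_involution_pchar2 (R : nzRingType) (T : finType) (S : pred T) (f : T -> T) :
    2%N \in [pchar R] -> (forall x, S x -> S (f x)) -> (forall x, S x -> f (f x) = x) ->
  \sum_(x | S x) 1 = \sum_(x | S x && (f x == x)) 1 :> R.
Proof.
move=> char2 fS fK; rewrite (bigID (fun x => f x == x)) /=.
rewrite -[RHS]addr0; congr (_ + _).
(* The order of [enum_rank] selects one point of each pair; reindexing by [f] identifies the two
   halves. *)
rewrite (bigID (fun x => enum_rank x < enum_rank (f x))%N) /=.
rewrite [X in _ + X](reindex_onto f f) /=; last by move=> x /andP[/andP[/fK]].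
rewrite [X in _ + X](eq_bigl
  (fun x => S x && (f x != x) && (enum_rank x < enum_rank (f x))%N)).
  exact: addrr_pchar2.
move=> x; have [Sx|nSx] := boolP (S x).
  rewrite fS // fK // eqxx andbT /= eq_sym -leqNgt; apply: andb_id2l => neq.
  by rewrite leq_eqVlt (inj_eq val_inj) (inj_eq enum_rank_inj) eq_sym (negPf neq).
apply/negbTE/negP => /andP[/andP[/andP[/fS Sffx _] _] /eqP ffx].
by move: nSx; rewrite -ffx Sffx.
Qed.

Lemma psi_psi3 N :
  eqX N (psi N * (psi N \Po 'X^3)) ((psi N \Po 'X^4) + 'X * (psi N \Po 'X^12)).
Proof.
apply/eqXP => m ltmN; rewrite psi_comp !psi_comp /psi !big_mkord.
pose S (ab : 'I_N * 'I_N) := (tri ab.1 + 3 * tri ab.2 == m)%N.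
(* The default of [insubd] is never reached on [S]: as i <= tri i, both entries of the flipped pair
   are at most m < N. *)
pose f (ab : 'I_N * 'I_N) : 'I_N * 'I_N :=
  (insubd ab.1 (flip (val ab.1, val ab.2)).1, insubd ab.2 (flip (val ab.1, val ab.2)).2).
have fE ab : S ab -> (val (f ab).1, val (f ab).2) = flip (val ab.1, val ab.2).
  case: ab => a b /eqP /= Sab; rewrite !val_insubd /=.
  have := tri_flip a b; have := leq_tri (flip (val a, val b)).1.
  have := leq_tri (flip (val a, val b)).2; rewrite /= in Sab *.
  by case: (flip _) => c d /= *; rewrite !ifT //; lia.
have fS ab : S ab -> S (f ab).
  move=> Sab; have := fE ab Sab; rewrite /S => fab; move: (Sab) => /eqP <-.
  by rewrite -(tri_flip ab.1 ab.2) -fab.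
have fK ab : S ab -> f (f ab) = ab.
  move=> Sab; have := fE _ (fS _ Sab); rewrite (fE _ Sab) flipK.
  by case: (f (f ab)) => c d; case: ab {Sab} => a b /= [/val_inj -> /val_inj ->].
have f_fix ab : S ab -> (f ab == ab) = (ab.1 == ab.2) || (val ab.1 == 3 * val ab.2 + 1)%N.
  by move=> Sab; rewrite -flip_fix -fE.
apply: (@etrans _ _ (\sum_(ab | S ab) (1 : 'F_2)%R)).
  rewrite big_distrlr pair_big coef_sum [RHS]big_mkcond; apply: eq_bigr => -[a b] _.
  by rewrite /= -exprD coefXn /S /= eq_sym; case: eqP.
rewrite (@sum_involution_pchar2 _ _ _ f) // ?pchar_Fp //.
(* Diagonal fixed points give psi(q^4); the others, with a = 3 b + 1, give q psi(q^12). *)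
rewrite (bigID (fun ab : 'I_N * 'I_N => ab.1 == ab.2)) /= coefD; congr (_ + _).
  rewrite (reindex_onto (fun i => (i, i)) fst) /=; last first.
    by move=> [a b] /andP[_ /eqP /= ->].
  rewrite coef_sum big_mkcond; apply: eq_bigr => i _; rewrite coefXn !eqxx !andbT.
  have [Sii|] := boolP (S (i, i)).
    rewrite f_fix //= eqxx; move: Sii; rewrite /S /= => /eqP <-.
    by rewrite (_ : _ == _); [|lia].
  by rewrite /S /= => Sii; rewrite (_ : (m == _) = false) //; apply/negbTE; lia.
rewrite (reindex_onto (fun i : 'I_N => (insubd i (3 * i + 1)%N, i)) snd) /=; last first.
  move=> [a b] /andP[/andP[Sab]]; rewrite f_fix //= => ab /negPf nab; congr pair.
  move: ab; rewrite nab /= => /eqP ab; apply: val_inj; rewrite val_insubd -ab.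
  by rewrite ltn_ord.
rewrite mulrC coefMX coef_sum.
rewrite (_ : (if _ then _ else _) = \sum_(i < N) (m == 12 * tri i + 1)%N%:R); last first.
  case: m ltmN {S f fE fS fK f_fix} => [|m] _ /=; last first.
    by apply: eq_bigr => i _; rewrite coefXn addn1.
  by rewrite big1 // => i _; rewrite addn1.
rewrite big_mkcond; apply: eq_bigr => i _; rewrite eqxx andbT.
have tri3 : tri (3 * i + 1) = (9 * tri i + 1)%N.
  by have := double_tri (3 * i + 1); have := double_tri i; nia.
have [lt3iN|] := ltnP (3 * i + 1) N.
  have v3i : insubd i (3 * i + 1)%N = (3 * i + 1)%N :> nat by rewrite val_insubd lt3iN.
  have [Si|] := boolP (S (insubd i (3 * i + 1)%N, i)).
    have ne3i : (insubd i (3 * i + 1)%N == i) = false.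
      by apply/negbTE/eqP=> e3i; move: v3i; rewrite e3i; lia.
    rewrite f_fix //= ne3i v3i eqxx /=.
    move: Si; rewrite /S /= v3i tri3 => /eqP <-.
    by rewrite (_ : (_ == _) = true) //; lia.
  by rewrite /S /= v3i tri3 => Si; rewrite (_ : (m == _) = false) //; apply/negbTE; lia.
(* Out of range, [insubd] returns i; the pair is then diagonal and excluded, while 12 tri i + 1
   exceeds m. *)
move=> leN3i; rewrite (_ : (m == _) = false); last by have := leq_tri (3 * i + 1); lia.
have -> : insubd i (3 * i + 1)%N = i by apply: val_inj; rewrite val_insubd ltnNge leN3i.
by rewrite eqxx !andbF.
Qed.

(** Only indices 3 k + 1 give triangular numbers that are 1 mod 3, and tri (3 k + 1) = 9 tri k +
    1. *)
Lemma section_psi N : section 3 1 (psi (3 * N)) = psi N \Po 'X^3.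
Proof.
elim: N => [|N IHN].
  rewrite /psi !big_geq // comp_poly0.
  by apply/polyP=> i; rewrite coef_section // !coef0.
have -> : (3 * N.+1 = (3 * N).+3)%N by lia.
rewrite !psiS !sectionD // IHN.
have sec b k : (b < 3)%N ->
    section 3 1 'X^(3 * k + b) = if 1%N == b then 'X^k else 0 :> {poly 'F_2}.
  by move=> lt_b; rewrite addnC exprD exprM -(comp_Xn_poly 'X^3 k) section_XnM_comp.
have -> : tri (3 * N) = (3 * (tri N + N ^ 2) + 0)%N.
  by have := double_tri (3 * N); have := double_tri N; nia.
have -> : tri (3 * N).+1 = (3 * (3 * tri N) + 1)%N.
  by have := double_tri (3 * N).+1; have := double_tri N; nia.
have -> : tri (3 * N).+2 = (3 * (tri N + N.+1 ^ 2) + 0)%N.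
  by have := double_tri (3 * N).+2; have := double_tri N; nia.
by rewrite !sec // !addr0 comp_polyD comp_Xn_poly -exprM.
Qed.

(** * The eta quotient modulo 2 *)

Lemma geomP d N : (0 < d)%N ->
  eqX N.+1 ((1 - 'X^d) * map_poly intr (geom d N)) (1 : {poly 'F_2}).
Proof.
move=> d_gt0.
have -> : map_poly intr (geom d N) = \sum_(i < N.+1) 'X^d ^+ i :> {poly 'F_2}.
  rewrite /geom rmorph_sum; apply: eq_bigr => i _.
  by rewrite /= map_polyXn exprM.
rewrite -[1 - _]opprB mulNr -subrX1 opprB -[X in eqX _ _ X]addr0.
apply: eqXD; first exact: eqX_refl.
by rewrite -exprM -['X^_]mul1r -mulNr; apply: eqX_XnM; nia.
Qed.

Lemma coef0_exp_eq1 (F : fieldType) (p : {poly F}) k : p`_0 = 1 -> (p ^+ k)`_0 = 1.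
Proof.
by move=> p0; elim: k => [|k IHk]; rewrite ?coef1 // exprS coef0M p0 IHk mulr1.
Qed.

(** Modulo 2, E_2^3 E_3^9 / (E_1^3 E_6^9) = E_1^3 / E_3^9. Multiplying by E_1^3 E_3^9 restores the
    original denominator, so that both sides compare factor by factor. *)
Lemma Fpoly_mod2 N (E := euler N.+1) :
  eqX N.+1 (map_poly intr (Fpoly N) * (E \Po 'X^3) ^+ 9) (E ^+ 3).
Proof.
apply: (@eqX_cancel _ _ (E ^+ 3 * (E \Po 'X^3) ^+ 9)).
  have E3 : (E \Po 'X^3)`_0 = 1 by rewrite coef_comp_poly_Xn //= euler_coef0.
  by rewrite coef0M !coef0_exp_eq1 ?mulr1 ?euler_coef0.
have -> : map_poly intr (Fpoly N) * (E \Po 'X^3) ^+ 9 * (E ^+ 3 * (E \Po 'X^3) ^+ 9)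
    = map_poly intr (Fpoly N) * (E ^+ 3 * (E \Po 'X^6) ^+ 9).
  have -> : E \Po 'X^6 = (E \Po 'X^3) ^+ 2 by rewrite sqr_polyF2 comp_polyXn_Xn.
  by ring.
have -> : E ^+ 3 * (E ^+ 3 * (E \Po 'X^3) ^+ 9) = (E \Po 'X^2) ^+ 3 * (E \Po 'X^3) ^+ 9.
  by rewrite -sqr_polyF2; ring.
rewrite /E !euler_comp /euler /Fpoly rmorph_prod -!prodrXl -!big_split /=.
apply: eqX_prod_nat => j /andP[j_gt0 _].
rewrite 3!rmorphM !rmorphXn !rmorphB !rmorph1 !rmorphXn /= !map_polyX.
set g1 := map_poly _ _; set g6 := map_poly _ _.
have -> : (1 - 'X^(2 * j)) ^+ 3 * (1 - 'X^(3 * j)) ^+ 9 * g1 ^+ 3 * g6 ^+ 9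
    * ((1 - 'X^j) ^+ 3 * (1 - 'X^(6 * j)) ^+ 9)
  = (1 - 'X^(2 * j)) ^+ 3 * (1 - 'X^(3 * j)) ^+ 9
    * (((1 - 'X^j) * g1) ^+ 3 * ((1 - 'X^(6 * j)) * g6) ^+ 9) :> {poly 'F_2}.
  by rewrite !exprMn; ring.
rewrite -[X in eqX _ _ X]mulr1; apply: eqXM; first exact: eqX_refl.
have g1P : eqX N.+1 ((1 - 'X^j) * g1) 1 by apply: geomP.
have g6P : eqX N.+1 ((1 - 'X^(6 * j)) * g6) 1 by apply: geomP; lia.
by have := eqXM (eqXexp 3 g1P) (eqXexp 9 g6P); rewrite !expr1n mulr1.
Qed.

(** * The successive extractions *)

Lemma section_compD_XMcomp (F : fieldType) (d : nat) (p q : {poly F}) : (1 < d)%N ->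
  section d 0 ((p \Po 'X^d) + 'X * (q \Po 'X^d)) = p.
Proof.
move=> d_gt1; have d_gt0 := ltnW d_gt1.
rewrite sectionD // -[p \Po _]mul1r -['X in X in _ + X]expr1 -(expr0 'X).
by rewrite !section_XnM_comp // addr0.
Qed.

(** The exponent is tracked as 24 u + 4, 6 u + 1, 2 u, u; each congruence is kept to a precision one
    above it. *)
Lemma Fcoef_mod2 u : exists N, (Fcoef (24 * u + 4))%:~R = (psi N)`_u.
Proof.
pose m := (24 * u + 4)%N; pose N := m.+1; exists N.
pose F : {poly 'F_2} := map_poly intr (Fpoly m).
pose E := euler N; pose E3 := E \Po 'X^3; pose P := psi N; pose P3 := P \Po 'X^3.
have FE : eqX N (F * E3 ^+ 9) (E ^+ 3) by exact: Fpoly_mod2.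
have EP : eqX N (E ^+ 3) P by exact: gauss.
have EP3 : eqX N (E3 ^+ 3) P3 by rewrite -rmorphXn; apply: eqX_comp.
have PP3 := psi_psi3 N; rewrite -/P -/P3 in PP3.
pose G := section 4 0 F; pose H := section 3 1 G; pose K := section 2 0 H.
(* A further factor E_3^3 = psi(q^3) completes E_3^12, a series in q^4. *)
have GE : eqX (6 * u + 2) (G * (E ^+ 3 \Po 'X^3)) P.
  rewrite -(@section_compD_XMcomp _ 4 P P3) // -section_mul_comp //.
  apply: (@eqX_section _ _ _ _ N) => //; first by rewrite /N /m; lia.
  rewrite [P3 \Po _]comp_polyXn_Xn; apply: eqX_trans PP3.
  have -> : F * ((E ^+ 3 \Po 'X^3) \Po 'X^4) = F * E3 ^+ 9 * E3 ^+ 3.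
    by rewrite -(exp2_polyF2 _ 2) rmorphXn /= -/E3; ring.
  by apply: eqXM => //; apply: eqX_trans FE EP.
(* E_3^3 is a series in q^3. The truncation is raised to 3 N to match [section_psi]. *)
have HE : eqX (2 * u + 1) (H * E ^+ 3) P3.
  rewrite /H -section_mul_comp // /P3 -section_psi.
  apply: (@eqX_trans _ _ (section 3 1 P)).
    by apply: (@eqX_section _ _ _ _ (6 * u + 2)) => //; lia.
  apply: (@eqX_section _ _ _ _ N) => //; first by rewrite /N /m; lia.
  by apply/eqX_sym/psi_le; lia.
(* A factor E_1^3 = psi makes E_1^6 = E_2^3, a series in q^2, and recreates psi(q) psi(q^3) on the
   right. *)
have KE : eqX (u + 1) (K * E ^+ 3) (P \Po 'X^2).
  rewrite -(@section_compD_XMcomp _ 2 (P \Po 'X^2) (P \Po 'X^6)) // -section_mul_comp //.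
  apply: (@eqX_section _ _ _ _ (2 * u + 1)) => //; first by lia.
  rewrite !comp_polyXn_Xn -sqr_polyF2 expr2 mulrA.
  have leN : (2 * u + 1 <= N)%N by rewrite /N /m; lia.
  apply: eqX_trans (eqX_le leN PP3); rewrite [P * P3]mulrC.
  by apply: eqXM => //; apply: eqX_le EP.
(* psi(q^2) = psi^2 = psi E_1^3, so E_1^3 cancels. *)
have KP : eqX (u + 1) K P.
  apply: (@eqX_cancel _ _ (E ^+ 3)); first by rewrite coef0_exp_eq1 ?euler_coef0.
  apply: eqX_trans KE _; rewrite -sqr_polyF2 expr2; apply: eqXM; first exact: eqX_refl.
  by apply/eqX_sym/(@eqX_le _ _ N) => //; rewrite /N /m; lia.
move/eqXP: KP => /(_ u); rewrite addn1 ltnSn => <- //.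
by rewrite /K !coef_section // coef_map /Fcoef; congr (_`_ _)%:~R; lia.
Qed.

(** * From triangular exponents to the congruence *)

Lemma coef_psi_neq0 N m : (psi N)`_m != 0 -> exists i, tri i = m.
Proof.
rewrite /psi coef_sum => nz.
suff /hasP[i _ /eqP] : has (fun i => tri i == m) (index_iota 0 N) by exists i.
apply: contraR nz => /hasPn no; apply/eqP; rewrite big_seq big1 // => i /no.
by rewrite coefXn eq_sym => /negPf ->.
Qed.

(* [3 (8 u + 1) + 1 = 24 u + 4], and [u] is triangular iff [8 u + 1] is a square. *)
Lemma dvd2_J6 (M : nat) :
  (M %% 8 = 1)%N -> (forall x, M <> x ^ 2)%N -> (2 %| J6 (3 * M)%N)%Z.
Proof.
move=> M1 nsq; have [u eM] : exists u, M = (8 * u + 1)%N by exists (M %/ 8)%N; lia.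
have -> : J6 (3 * M)%N = Fcoef (24 * u + 4).
  rewrite eM (_ : 3 * (8 * u + 1) = (24 * u + 2).+1)%N; last by lia.
  by rewrite /J6 mulr0 subr0; congr Fcoef; lia.
apply: F2_intr_eq0; have [N ->] := Fcoef_mod2 u.
apply/eqP/negPn/negP => /coef_psi_neq0[i ti]; apply: (nsq (2 * i + 1)%N).
by have := double_tri i; nia.
Qed.

Unset Implicit Arguments.

(* p i for i < k is p_{i+1}; p k is p_{k+1}. *)
Theorem theorem3p4 (k n : nat) (p : nat -> nat)
  (hp : forall i : nat, (i <= k)%N -> prime (p i) && ((p i %% 8)%N \in [:: 3; 5; 7]%N))
  (j : int) (hj : ~~ ((p k)%:Z %| j)%Z) :
  (2 %| J6 (3 * (\prod_(i < k) (p i ^ 2)%N)%:Z * (p k)%:Z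
            * (8 * (p k)%:Z * n%:Z + 8 * j + (p k)%:Z)))%Z.
Proof.
have odd_p i : (i <= k)%N -> odd (p i).
  by case/hp/andP => _; rewrite !inE => /or3P[] /eqP; lia.
have /andP[pr_p _] := hp k (leqnn k).
pose Q := (\prod_(i < k) p i)%N.
have -> : (\prod_(i < k) (p i ^ 2) = Q ^ 2)%N.
  by rewrite /Q; elim/big_rec2: _ => [|i x y _ ->]; rewrite ?exp1n ?expnMn.
have odd_Q : odd Q.
  rewrite /Q; apply: (big_ind odd) => // [x y ox oy|i _]; first by rewrite oddM ox.
  by apply: odd_p; apply: ltnW.
have := odd_p k (leqnn k); set q := p k in pr_p hj * => odd_q.
have Q_gt0 := odd_gt0 odd_Q; have q_gt0 := odd_gt0 odd_q.
case er: (8 * q%:Z * n%:Z + 8 * j + q%:Z) => [r|r]; last first.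
  have A_gt0 : (0 < Q ^ 2 * q)%N by rewrite muln_gt0 expn_gt0 Q_gt0.
  (* A negative index is at most -3, beyond the simple pole, so the coefficient is 0 by
     definition. *)
  have -> : 3 * (Q ^ 2)%N%:Z * q%:Z * Negz r = Negz (3 * (Q ^ 2 * q) * r.+1 - 2).+1.
    rewrite -[3 * _ * _]mulrA -PoszM; nia.
  exact: dvdz0.
have -> : (3 * (Q ^ 2)%N%:Z * q%:Z * Posz r) = (3 * (Q ^ 2 * q * r))%N%:Z :> int.
  by rewrite !PoszM !mulrA.
apply: dvd2_J6.
  (* r = q mod 8, so Q^2 q r is an odd square mod 8, that is 1. *)
  have r8 : (r %% 8 = q %% 8)%N by have := er; rewrite -mulrA; lia.
  have sqr8 m : odd m -> (m * m %% 8 = 1)%N.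
    rewrite -modnMm => om; have : (m %% 8 \in [:: 1; 3; 5; 7])%N by rewrite !inE; lia.
    by rewrite !inE => /or4P[] /eqP ->.
  have qr8 : (q * r %% 8 = 1)%N by rewrite -modnMmr r8 modnMmr sqr8.
  by rewrite -mulnA -modnMm qr8 sqr8.
(* r = 8 j mod q with q odd, so q | r would force q | j. *)
have nqr : ~~ (q %| r)%N.
  apply: contra hj => /dvdnP[t rt].
  have : (q%:Z %| 8 * j)%Z.
    have -> : 8 * j = q%:Z * (t%:Z - 8 * n%:Z - 1).
      by move: er; rewrite rt PoszM => /(canRL (addrK _)) /(canRL (addKr _)) ->; ring.
    exact: dvdz_mulr.
  have cq8 : coprime q 8 by rewrite -[8%N]/(2 ^ 3)%N coprimeXr ?coprimen2.
  by rewrite Gauss_dvdzr.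
have r_gt0 : (0 < r)%N by case: r nqr {er} => //; rewrite dvdn0.
(* The q-adic valuation is 2 v(Q) + 1 on one side and even on the other. *)
move=> x ex; have := congr1 (logn q) ex.
rewrite lognX !lognM ?muln_gt0 ?expn_gt0 ?Q_gt0 // (logn_prime q pr_p) eqxx.
by rewrite (@logn_coprime q r) ?prime_coprime //; lia.
Qed.
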